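(* Let $A,B$ be two solid, closed, convex sets in $\mathbb{R}^n$ with $A\cap B\neq\emptyset$ that satisfy condition (C) at every point $x^*\in A\cap B$. Assume there is $\hat\kappa>0$ such that $A,B$ are $\hat\kappa$-linearly regular at every $x^*\in A\cap B$, i.e. for every $x^*\in A\cap B$ there is $\delta_{x^*}>0$ with $$d_{A\cap B}(x)\le\hat\kappa\max(d_A(x),d_B(x))\quad\forall x\in\mathcal{B}_{\delta_{x^*}}(x^* ).$$ Let $\kappa=\max(\hat\kappa,\sqrt2)$. Then the GAP algorithm $x_{k+1}=\Pi_A^{\alpha_2}\Pi_B^{\alpha_1}x_k$ with parameters $$\alpha=1,\quad\alpha_1=\alpha_2=2\left(\frac{\kappa}{\sqrt{\kappa^2-1}+1}\right)^2$$ converges to a point $x^*\in A\cap B$ R-linearly with rate $\mu$ for any $\mu\in(\gamma,1)$, where $$\gamma=\left(\frac{\sqrt{\kappa^2-1}-1}{\sqrt{\kappa^2-1}+1}\right)^2=1-4\frac{\sqrt{\kappa^2-1}}{\kappa^2+2\sqrt{\kappa^2-1}}.$$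
   Context: Solid means nonempty interior; $\Pi_C$ is the projection onto $C$, $\Pi_C^\alpha:=(1-\alpha)I+\alpha\Pi_C$; $d_C$ is the distance to $C$; $\mathcal{B}_\delta(x)$ is the closed ball. A set $\mathcal{M}$ is a $\mathcal{C}^k$-manifold around $x$ if there is an open $U\ni x$ with $\mathcal{M}\cap U=\{y:F(y)=0\}$ for a $\mathcal{C}^k$ map $F:U\to\mathbb{R}^d$ with surjective derivative throughout $U$; $T_{\mathcal{M}}(x)=\ker DF(x)$. Two manifolds satisfy the regularity assumption at $x$ if they are $\mathcal{C}^k$-smooth ($k\ge2$) around $x$, their intersection is a $\mathcal{C}^k$ manifold around $x$, and $T_{\mathcal{M}\cap\mathcal{N}}(x)=T_{\mathcal{M}}(x)\cap T_{\mathcal{N}}(x)$. Condition (C) at $x^*\in A\cap B$: at least one of (C1) $x^*\in\operatorname{bd}A\cap\operatorname{bd}B$ and $(\operatorname{bd}A,\operatorname{bd}B)$ satisfy the regularity assumption at $x^*$; (C2) $x^*\in\operatorname{int}A\cap\operatorname{bd}B$ with $\operatorname{bd}B$ a $\mathcal{C}^2$ manifold around $x^*$; (C3) $x^*\in\operatorname{bd}A\cap\operatorname{int}B$ with $\operatorname{bd}A$ a $\mathcal{C}^2$ manifold around $x^*$; (C4) $x^*\in\operatorname{int}A\cap\operatorname{int}B$. R-linear convergence with rate $\mu$: there is $C>0$ with $\|x_k-x^*\|\le C\mu^k$ for all $k$. *)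

(* Defs.v *)
From HB Require Import structures.
From mathcomp Require Import all_boot all_order all_algebra.
From mathcomp Require Import all_classical all_reals all_analysis.
Set Implicit Arguments. Unset Strict Implicit. Unset Printing Implicit Defensive.
Import Order.TTheory GRing.Theory Num.Theory.
Import numFieldNormedType.Exports.
Local Open Scope classical_set_scope.
Local Open Scope ring_scope.

Section Defs.
Variables (R : realType) (n : nat).
Local Notation V := 'rV[R]_n.

Definition enorm (x : V) : R := Num.sqrt (\sum_(i < n) (x ord0 i) ^+ 2).

Definition dist (C : set V) (x : V) : R := inf [set enorm (x - y) | y in C].

Definition is_proj (C : set V) (x p : V) : Prop :=
  C p /\ forall y, C y -> enorm (x - p) <= enorm (x - y).

Definition relax (P : V -> V) (a : R) (x : V) : V := (1 - a) *: x + a *: P x.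

Definition gap_seq (PA PB : V -> V) (alpha a1 a2 : R) (x0 : V) (k : nat) : V :=
  iter k (fun x => (1 - alpha) *: x + alpha *: relax PA a2 (relax PB a1 x)) x0.

Definition bd (C : set V) : set V := closure C `\` interior C.

Fixpoint Ck (d : nat) (k : nat) (U : set V) (F : V -> 'rV[R]_d) : Prop :=
  match k with
  | 0 => forall x, U x -> {for x, continuous F}
  | k'.+1 => (forall x, U x -> differentiable F x) /\
             forall i : 'I_n, Ck k' U (fun y => 'D_(delta_mx ord0 i) F y)
  end.

Definition chart (k : nat) (M : set V) (x : V) (U : set V) (d : nat)
    (F : V -> 'rV[R]_d) : Prop :=
  [/\ open U, U x, Ck k U F,
      (forall y, U y -> forall w : 'rV[R]_d, exists v : V, 'd F y v = w) &
      M `&` U = [set y | U y /\ F y = 0]].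

Definition manifold_around (k : nat) (M : set V) (x : V) : Prop :=
  exists U d (F : V -> 'rV[R]_d), chart k M x U F.

(* regularity assumption for (M, N) at x; tangent space T(x) = ker DF(x) *)
Definition regular_pair (M N : set V) (x : V) : Prop :=
  exists k, (2 <= k)%N /\
  exists UM dM (FM : V -> 'rV[R]_dM) UN dN (FN : V -> 'rV[R]_dN)
         UI dI (FI : V -> 'rV[R]_dI),
    [/\ chart k M x UM FM, chart k N x UN FN, chart k (M `&` N) x UI FI &
        forall v : V, 'd FI x v = 0 <-> ('d FM x v = 0 /\ 'd FN x v = 0)].

Definition condC (A B : set V) (x : V) : Prop :=
  [\/ [/\ bd A x, bd B x & regular_pair (bd A) (bd B) x],
      [/\ interior A x, bd B x & manifold_around 2 (bd B) x],
      [/\ bd A x, interior B x & manifold_around 2 (bd A) x] |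
      interior A x /\ interior B x].

End Defs.

(* Main.v *)
Require Import Defs.
From HB Require Import structures.
From mathcomp Require Import all_boot all_order all_algebra.
From mathcomp Require Import all_classical all_reals all_analysis.
From mathcomp Require Import ring lra.
Import Order.TTheory GRing.Theory Num.Theory.
Import numFieldNormedType.Exports.
Local Open Scope classical_set_scope.
Local Open Scope ring_scope.

(* Interleave the half-steps: z_(j+1) = z_j - a (z_j - P_j z_j), with P_j
   alternately the projection onto B and onto A, and let w_j = |z_j - P_j z_j|.
   Fejer monotonicity gives z_j -> x* in A and B. The charts force the unit
   normals of A and B near x* to approach single vectors u and v, which yields
     w_(j+2) <= max (0, - a (u.v) w_(j+1) - (a - 1) w_j + o (w_(j+1) + w_j)).
   Linear regularity along u + v bounds the angle between u and v, so that
   - a (u.v) <= 2 rho where rho^2 = a - 1 = gamma: the characteristic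
   polynomial has at worst the double root rho, whence w_j = O (m^j) for every
   m > rho. If v = - u this bound is void; then linear regularity makes A and B
   half-spaces near x*, and w is exactly geometric. The rate for the iterates
   z_(2k) follows by summing the steps. *)

Set Implicit Arguments. Unset Strict Implicit. Unset Printing Implicit Defensive.

(** * Euclidean inner product, norm and topology on row vectors *)

Section Euclid.
Context {R : realType} {n : nat}.
Local Notation V := 'rV[R]_n.
Implicit Types (x y z p q u v w : V) (A B : set V) (P : V -> V).

Definition dot x y : R := \sum_(i < n) x ord0 i * y ord0 i.

Lemma dotC x y : dot x y = dot y x.
Proof. by apply: eq_bigr => i _; rewrite mulrC. Qed.

Lemma dotDl x y z : dot (x + y) z = dot x z + dot y z.
Proof. by rewrite -big_split; apply: eq_bigr => i _; rewrite mxE mulrDl. Qed.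

Lemma dotZl (a : R) x y : dot (a *: x) y = a * dot x y.
Proof. by rewrite mulr_sumr; apply: eq_bigr => i _; rewrite mxE mulrA. Qed.

Lemma dotNl x y : dot (- x) y = - dot x y.
Proof. by rewrite -scaleN1r dotZl mulN1r. Qed.

Lemma dotDr x y z : dot z (x + y) = dot z x + dot z y.
Proof. by rewrite dotC dotDl !(dotC z). Qed.

Lemma dotZr (a : R) x y : dot x (a *: y) = a * dot x y.
Proof. by rewrite dotC dotZl dotC. Qed.

Lemma dotNr x y : dot x (- y) = - dot x y.
Proof. by rewrite dotC dotNl dotC. Qed.

Lemma dot0l x : dot 0 x = 0.
Proof. by rewrite -(scale0r 0) dotZl mul0r. Qed.

Definition dotE := (dotDl, dotDr, dotNl, dotNr, dotZl, dotZr).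

Lemma dot_ge0 x : 0 <= dot x x.
Proof. by apply: sumr_ge0 => i _; rewrite -expr2 sqr_ge0. Qed.

Lemma enormE x : enorm x = Num.sqrt (dot x x).
Proof. by congr Num.sqrt; apply: eq_bigr => i _; rewrite expr2. Qed.

Lemma enorm_ge0 x : 0 <= enorm x.
Proof. exact: sqrtr_ge0. Qed.

Lemma enorm_sqr x : enorm x ^+ 2 = dot x x.
Proof. by rewrite enormE sqr_sqrtr ?dot_ge0. Qed.

Lemma enorm0 : enorm (0 : V) = 0.
Proof. by rewrite enormE dot0l sqrtr0. Qed.

Lemma enorm0_eq0 x : enorm x = 0 -> x = 0.
Proof.
move=> x0; have := enorm_sqr x; rewrite x0 expr0n /= => /esym /eqP.
rewrite psumr_eq0 => [/allP h|i _]; last by rewrite -expr2 sqr_ge0.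
apply/rowP => i; rewrite mxE; apply/eqP.
by have := h i (mem_index_enum i); rewrite mulf_eq0 orbb.
Qed.

Lemma enorm_gt0 x : x <> 0 -> 0 < enorm x.
Proof.
move=> x0; rewrite lt_neqAle enorm_ge0 andbT; apply/eqP => h.
by apply: x0; apply: enorm0_eq0.
Qed.

Lemma enormZ (a : R) x : enorm (a *: x) = `|a| * enorm x.
Proof.
by rewrite !enormE dotZl dotZr mulrA -expr2 sqrtrM ?sqr_ge0 // sqrtr_sqr.
Qed.

Lemma enormN x : enorm (- x) = enorm x.
Proof. by rewrite -scaleN1r enormZ normrN1 mul1r. Qed.

Lemma enormBC x y : enorm (x - y) = enorm (y - x).
Proof. by rewrite -enormN opprB. Qed.

Lemma enorm_le x (a : R) : 0 <= a -> dot x x <= a ^+ 2 -> enorm x <= a.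
Proof.
move=> a0 h; rewrite enormE -(ger0_norm a0) -sqrtr_sqr; exact: ler_wsqrtr.
Qed.

Lemma enorm_sqrD x y :
  enorm (x + y) ^+ 2 = enorm x ^+ 2 + 2 * dot x y + enorm y ^+ 2.
Proof. by rewrite !enorm_sqr !dotE (dotC y x); ring. Qed.

(** Cauchy-Schwarz, from expanding the square of [enorm y *: x - enorm x *: y]. *)
Lemma dot_le x y : dot x y <= enorm x * enorm y.
Proof.
have [y0|y0] := eqVneq (enorm y) 0.
  by rewrite y0 (enorm0_eq0 y0) mulr0 dotC dot0l.
have yp : 0 < enorm y by rewrite lt_neqAle eq_sym y0 enorm_ge0.
have := dot_ge0 (enorm y *: x - enorm x *: y).
rewrite !dotE (dotC y x) -!enorm_sqr => h.
have [x0|x0] := eqVneq (enorm x) 0.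
  by rewrite x0 (enorm0_eq0 x0) mul0r dot0l.
have xp : 0 < enorm x by rewrite lt_neqAle eq_sym x0 enorm_ge0.
have h2 : 0 <= (enorm x * enorm y) * (enorm x * enorm y - dot x y) by nra.
by rewrite pmulr_rge0 ?subr_ge0 // mulr_gt0 in h2.
Qed.

Lemma enormD x y : enorm (x + y) <= enorm x + enorm y.
Proof.
apply: enorm_le; first by rewrite addr_ge0 ?enorm_ge0.
rewrite !dotE (dotC y x) -!enorm_sqr.
by have := dot_le x y; nra.
Qed.

Lemma enormB x y z : enorm (x - z) <= enorm (x - y) + enorm (y - z).
Proof. by apply: le_trans (enormD _ _); rewrite addrA subrK. Qed.

Lemma normr_le_enorm x : `|x| <= enorm x.
Proof.
rewrite /Num.Def.normr /= mx_normrE; apply: bigmax_le; first exact: enorm_ge0.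
case=> i j _ /=; rewrite (ord1 i) -sqrtr_sqr; apply: ler_wsqrtr.
rewrite (bigD1 j) //= lerDl; apply: sumr_ge0 => k _; exact: sqr_ge0.
Qed.

Lemma enorm_le_normr x : enorm x <= n%:R * `|x|.
Proof.
apply: enorm_le; first by rewrite mulr_ge0.
apply: (@le_trans _ _ (\sum_(i < n) `|x| ^+ 2)).
  apply: ler_sum => i _; rewrite -expr2 -real_normK ?num_real //.
  rewrite lerXn2r ?nnegrE //.
  rewrite {2}/Num.Def.normr /= mx_normrE.
  by rewrite (@le_bigmax _ _ _ _ (fun ij : 'I_1 * 'I_n => `|x ij.1 ij.2|) (ord0, i)).
rewrite sumr_const card_ord exprMn -[X in X <= _]mulr_natl ler_wpM2r ?sqr_ge0 //.
by rewrite -natrX ler_nat; case: (n) => // k; rewrite leq_pmulr.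
Qed.

(** The ambient topology comes from the sup norm; equivalence of the two norms allows testing
    neighbourhoods on Euclidean balls. *)
Lemma nbhs_enorm x (A : set V) :
  nbhs x A <-> exists2 d : R, 0 < d & forall y, enorm (y - x) < d -> A y.
Proof.
split.
  move=> /nbhs_ballP[d /= d0 dA]; exists d => // y yx; apply: dA.
  rewrite -ball_normE /ball_ /= distrC.
  by apply: le_lt_trans yx; exact: normr_le_enorm.
case=> d d0 dA; apply/nbhs_ballP; exists (d / (n%:R + 1)) => /=.
  by rewrite divr_gt0 // ltr_wpDl.
move=> y; rewrite -ball_normE /ball_ /= distrC => yx; apply: dA.
apply: le_lt_trans (enorm_le_normr _) _.
rewrite ltr_pdivlMr ?ltr_wpDl // in yx; apply: le_lt_trans yx.
by rewrite mulrC ler_wpM2l // lerDl.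
Qed.

Lemma closed_enorm A x : closed A ->
  (forall e : R, 0 < e -> exists2 y, A y & enorm (y - x) < e) -> A x.
Proof.
move=> cA h; apply: cA => N /nbhs_enorm [d d0 dN].
by have [y Ay yx] := h _ d0; exists y; split=> //; apply: dN.
Qed.

Lemma convexE A x y (t : R) : convex_set A -> A x -> A y -> 0 <= t -> t <= 1 ->
  A (x + t *: (y - x)).
Proof.
move=> cA Ax Ay t0 t1.
have ti : Itv.spec (@Itv.num_sem R) (Itv.Real `[0%Z, 1%Z]) t.
  by rewrite /Itv.spec /= /Itv.num_sem /= num_real in_itv /= t0 t1.
have := cA y x (Itv.mk ti); rewrite !inE => /(_ Ay Ax).
congr (A _); rewrite /conv /=.
apply/rowP => i; rewrite !mxE /= /unstable.onem; ring.
Qed.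

End Euclid.

(** * Normal cones, projections and limits of unit normals *)

Section Normals.
Context {R : realType} {n : nat}.
Local Notation V := 'rV[R]_n.
Implicit Types (x y z p q u v w : V) (A B : set V) (P : V -> V).

Definition normal A p u := forall y, A y -> dot u (y - p) <= 0.

(* Unit normals of [A] at points tending to [x] tend to [u]; vacuous, hence
   true of every [u], when [x] is interior to [A]. *)
Definition normals_near A x u := forall e : R, 0 < e -> exists2 d : R, 0 < d &
  forall p w, A p -> enorm (p - x) <= d -> enorm w = 1 -> normal A p w ->
    enorm (w - u) <= e.

Lemma proj_normal A x p : convex_set A -> is_proj A x p -> normal A p (x - p).
Proof.
move=> cA [Ap min_p] y Ay; rewrite leNgt; apply/negP => D0.
set D := dot (x - p) (y - p) in D0 *; set N := dot (y - p) (y - p).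
have N0 : 0 <= N by exact: dot_ge0.
have DN : 0 < D + N by rewrite ltr_wpDr.
(* If [D > 0], moving from [p] to [p + t (y - p)] lowers the squared distance to [x] by
   [t (2 D - t N)]. This [t] is at most 1 and satisfies [t N < D], so the decrease is positive. *)
set t := D / (D + N).
have t0 : 0 < t by exact: divr_gt0.
have t1 : t <= 1 by rewrite ler_pdivrMr // mul1r lerDl.
have tDN : t * (D + N) = D by rewrite divfK // gt_eqF.
have := min_p _ (convexE cA Ap Ay (ltW t0) t1).
rewrite opprD addrA => h.
have : enorm (x - p) ^+ 2 <= enorm (x - p - t *: (y - p)) ^+ 2.
  by rewrite ler_sqr ?nnegrE ?enorm_ge0.
rewrite [X in _ <= X]enorm_sqrD enormN enormZ exprMn real_normK ?num_real // dotNr dotZr.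
rewrite (enorm_sqr (y - p)) -/D -/N => {}h.
have tD : 0 < t * D by exact: mulr_gt0.
have tND : 0 < t * (D - t * N) by rewrite mulr_gt0 //; rewrite mulrDr in tDN; lra.
lra.
Qed.

(** Pythagoras with an obtuse angle at [p], the angle being controlled by [proj_normal]. *)
Lemma proj_dist A x p c : convex_set A -> is_proj A x p -> A c ->
  enorm (x - c) ^+ 2 >= enorm (x - p) ^+ 2 + enorm (p - c) ^+ 2.
Proof.
move=> cA hp Ac; have := proj_normal cA hp Ac.
have -> : x - c = (x - p) + (p - c) by rewrite addrA subrK.
rewrite (enorm_sqrD (x - p)) -(opprB c p) dotNr; lra.
Qed.

Lemma proj_dist_le A x p c : convex_set A -> is_proj A x p -> A c ->
  enorm (p - c) <= enorm (x - c).
Proof.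
move=> cA hp Ac; rewrite -ler_sqr ?nnegrE ?enorm_ge0 //.
by apply: le_trans (proj_dist cA hp Ac); rewrite lerDr sqr_ge0.
Qed.

Lemma proj_unit_normal A x p : convex_set A -> is_proj A x p ->
  0 < enorm (x - p) ->
  exists w, [/\ enorm w = 1, normal A p w & x - p = enorm (x - p) *: w].
Proof.
move=> cA hp x0; exists ((enorm (x - p))^-1 *: (x - p)); split.
- by rewrite enormZ ger0_norm ?invr_ge0 ?enorm_ge0 // mulVf ?gt_eqF.
- move=> y Ay; rewrite dotZl pmulr_rle0 ?invr_gt0 //; exact: proj_normal Ay.
- by rewrite scalerA divff ?gt_eqF // scale1r.
Qed.

Lemma dist_le_proj A x p : is_proj A x p -> dist A x <= enorm (x - p).
Proof.
move=> [Ap _]; apply: ge_inf; last by exists p.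
by exists 0 => _ [y _ <-]; exact: enorm_ge0.
Qed.

Lemma le_dist A x (t : R) : A !=set0 -> (forall y, A y -> t <= enorm (x - y)) ->
  t <= dist A x.
Proof.
move=> [y Ay] h; apply: lb_le_inf; first by exists (enorm (x - y)); exists y.
by move=> _ [z Az <-]; exact: h.
Qed.

(** Near an interior point there are no unit normals: a short step along [w] from [p] would stay in
    [A]. *)
Lemma interior_normals_near A x u : interior A x -> normals_near A x u.
Proof.
move=> /nbhs_enorm [d d0 dA] e e0; exists (d / 2); first by rewrite divr_gt0.
move=> p w Ap px w1 nw; exfalso.
have : A (p + (d / 4) *: w).
  apply: dA; rewrite addrAC; apply: le_lt_trans (enormD _ _) _.
  by rewrite enormZ w1 ger0_norm; lra.
move=> /nw; rewrite addrC addKr dotZr -enorm_sqr w1; lra.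
Qed.

(** Points outside [A] tending to [x] have projections tending to [x], with unit normals tending to
    [u]; the normal inequality passes to the limit. *)
Lemma bd_normal A P x u : closed A -> convex_set A -> (forall y, is_proj A y (P y)) ->
  bd A x -> normals_near A x u -> normal A x u.
Proof.
move=> clA cA hP [clAx nintA] nA y Ay.
have Ax : A x by rewrite (iffLR (closure_id A) clA).
apply/ler_addgt0Pr => e e0; rewrite add0r.
set M := enorm (y - x) + 1.
have M0 : 0 < M by rewrite ltr_wpDl ?enorm_ge0.
have [d d0 hd] := nA (e / (2 * M)) (divr_gt0 e0 (mulr_gt0 (ltr0n _ 2) M0)).
set d' := Num.min d (e / 2).
have d'0 : 0 < d' by rewrite lt_min d0 divr_gt0.
have [z zx nAz] : exists2 z, enorm (z - x) < d' & ~ A z.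
  apply: contrapT => h; apply: nintA; apply/nbhs_enorm; exists d' => // z zx.
  by apply: contrapT => nAz; apply: h; exists z.
have zP : 0 < enorm (z - P z).
  apply: enorm_gt0 => /eqP; rewrite subr_eq0 => /eqP zE.
  by apply: nAz; rewrite zE; case: (hP z).
have [w [w1 nw _]] := proj_unit_normal cA (hP z) zP.
have px : enorm (P z - x) < d' by apply: le_lt_trans zx; exact: proj_dist_le (hP z) Ax.
rewrite lt_min in px; case/andP: px => px1 px2.
have wu := hd _ _ (proj1 (hP z)) (ltW px1) w1 nw.
have -> : dot u (y - x) = dot w (y - P z) + dot w (P z - x) - dot (w - u) (y - x).
  by rewrite -dotDr addrA subrK dotDl dotNl; ring.
have h1 := nw _ Ay.
have h2 : dot w (P z - x) <= e / 2.
  by apply: le_trans (dot_le _ _) _; rewrite w1 mul1r ltW.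
have h3 : - dot (w - u) (y - x) <= e / 2.
  rewrite -dotNl; apply: le_trans (dot_le _ _) _; rewrite enormN.
  apply: (@le_trans _ _ (e / (2 * M) * M)).
    by rewrite ler_pM ?enorm_ge0 // lerDl.
  suff -> : e / (2 * M) * M = e / 2 by [].
  by field; rewrite gt_eqF.
lra.
Qed.

End Normals.

(** * Charts of the boundary and the limiting unit normal *)

Section Boundary.
Context {R : realType} {n : nat}.
Local Notation V := 'rV[R]_n.
Implicit Types (x y z p q u v w g : V) (A B M : set V).

(** That is, [dot g q = o(|q|)] on [M]: to first order [M] lies in the hyperplane through [x]
    orthogonal to [g]. *)
Definition almost_orthogonal M x g := forall e : R, 0 < e -> exists2 d : R, 0 < d &
  forall q, M (x + q) -> enorm q <= d -> `|dot g q| <= e * enorm q.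

Lemma almost_orthogonalN M x g :
  almost_orthogonal M x g -> almost_orthogonal M x (- g).
Proof.
move=> h e /h [d d0 hd]; exists d => // q Mq qd.
by rewrite dotNl normrN; exact: hd.
Qed.

(** The vector [g] is the normalized gradient of the first component of [F]. As [F] vanishes at [x]
    and [x + q], its derivative at [x] sends [q] to [o(|q|)]; surjectivity makes the gradient
    nonzero. *)
Lemma chart_orthogonal (k : nat) M x (U : set V) (d : nat) (F : V -> 'rV[R]_d) :
  chart k.+1 M x U F -> M x -> (0 < d)%N ->
  exists2 g, enorm g = 1 & almost_orthogonal M x g.
Proof.
case: d F => [//|d] F [oU Ux [dF _] sF MU] Mx _.
have /(_ _) F0 y : M y -> U y -> F y = 0.
  by move=> My Uy; have : (M `&` U) y by []; rewrite MU => -[].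
set g0 : V := \row_i ('d F x (delta_mx ord0 i)) ord0 ord0.
have g0E q : dot g0 q = ('d F x q) ord0 ord0.
  rewrite [in RHS](row_sum_delta q) linear_sum summxE; apply: eq_bigr => i _.
  by rewrite linearZ !mxE mulrC.
have [v vE] := sF x Ux (delta_mx ord0 ord0).
have g0n : 0 < enorm g0.
  apply: enorm_gt0 => g00; have := g0E v.
  by rewrite vE g00 dot0l mxE eqxx => /esym/eqP; rewrite oner_eq0.
exists ((enorm g0)^-1 *: g0).
  by rewrite enormZ ger0_norm ?invr_ge0 ?enorm_ge0 // mulVf // gt_eqF.
move=> e e0.
have /nbhs_enorm [d1 d10 hd1] : nbhs x U by exact: open_nbhs_nbhs.
have := diff_locallyx (dF x Ux).
move=> /funext /eqaddoP /(_ (e * enorm g0) (mulr_gt0 e0 g0n)) /nbhs_enorm [d2 d20 hd2].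
exists (Num.min d1 d2 / 2); first by rewrite divr_gt0 // lt_min d10.
move=> q Mq qd.
have qm : enorm q < Num.min d1 d2.
  by apply: le_lt_trans qd _; rewrite gtr_pMr ?lt_min ?d10 // invf_lt1 // ltr1n.
rewrite lt_min in qm; case/andP: qm => q1 q2.
have Uq : U (x + q) by apply: hd1; rewrite addrC addKr.
have := hd2 q; rewrite subr0 => /(_ q2) /=.
rewrite fctE (addrC q) (F0 _ Mq Uq) (F0 _ Mx Ux) sub0r add0r normrN => hq.
rewrite dotZl normrM ger0_norm ?invr_ge0 ?enorm_ge0 // g0E mulrC ler_pdivrMr //.
apply: (@le_trans _ _ `|'d F x q|).
  rewrite [X in _ <= X]/Num.Def.normr /= mx_normrE.
  exact: (@le_bigmax _ _ _ _ (fun ij : 'I_1 * 'I_d.+1 => `|('d F x q) ij.1 ij.2|) (ord0, ord0)).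
apply: le_trans hq _; rewrite mulrAC ler_wpM2r ?enorm_ge0 //.
by rewrite ler_wpM2l ?(ltW e0) // normr_le_enorm.
Qed.

(** For [d = 0] the equation [F = 0] is void, so a whole neighbourhood of [x] would lie in [bd A]
    and hence in [A]. *)
Lemma chart_dim_gt0 (k : nat) A x (U : set V) (d : nat) (F : V -> 'rV[R]_d) :
  closed A -> bd A x -> chart k (bd A) x U F -> (0 < d)%N.
Proof.
case: d F => [F|//] clA [_ nint] [oU Ux _ _ MU]; exfalso; apply: nint.
apply: (@filterS _ _ _ U); last exact: open_nbhs_nbhs.
move=> y Uy; have : (bd A `&` U) y.
  by rewrite MU; split=> //; apply/rowP; case.
by case=> -[+ _] _; rewrite -(iffLR (closure_id A) clA).
Qed.

Lemma bd_crossing A x y : closed A -> A x -> ~ A y ->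
  exists s : R, [/\ 0 <= s, s <= 1 & bd A (x + s *: (y - x))].
Proof.
move=> clA Ax nAy.
set S := [set s : R | [/\ 0 <= s, s <= 1 & A (x + s *: (y - x))]].
have S0 : S 0 by split=> //; rewrite ?ler01 // scale0r addr0.
have hS : has_sup S by split; [exists 0|exists 1 => s []].
set L := enorm (y - x) + 1.
have L0 : 0 < L by rewrite ltr_wpDl ?enorm_ge0.
have moveE (s t : R) : enorm (x + s *: (y - x) - (x + t *: (y - x))) <= `|s - t| * L.
  rewrite opprD addrACA subrr add0r -scalerBl enormZ ler_wpM2l //.
  by rewrite lerDl.
have s0 : 0 <= sup S by apply: ub_le_sup => //; exact: (proj2 hS).
have s1 : sup S <= 1 by apply: ge_sup; [exists 0|move=> s []].
have As : A (x + sup S *: (y - x)).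
  apply: closed_enorm => // e e0.
  have [s [s0' s1' As] ss] := sup_adherent (divr_gt0 e0 L0) hS.
  exists (x + s *: (y - x)) => //; apply: le_lt_trans (moveE _ _) _.
  rewrite -ltr_pdivlMr // ltr_norml; apply/andP; split; first lra.
  have : s <= sup S by apply: ub_le_sup => //; exact: (proj2 hS).
  by have := divr_gt0 e0 L0; lra.
exists (sup S); split=> //; split; first exact: subset_closure.
move=> /nbhs_enorm [d d0 dA].
have slt : sup S < 1.
  rewrite lt_neqAle s1 andbT; apply/eqP => sE; apply: nAy; move: As.
  by rewrite sE scale1r addrC subrK.
(* Were the last point of the segment in [A] interior, a parameter slightly beyond the supremum
   would still belong to [S]. *)
set s := Num.min 1 (sup S + d / (2 * L)).
have dL : 0 < d / (2 * L) by rewrite divr_gt0 // mulr_gt0.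
have ss : sup S < s by rewrite lt_min slt ltrDl.
have : S s.
  split; [by apply: ltW; apply: le_lt_trans ss|by rewrite ge_min lexx|].
  apply: dA; apply: le_lt_trans (moveE _ _) _.
  rewrite gtr0_norm ?subr_gt0 // -ltr_pdivlMr //.
  have : s <= sup S + d / (2 * L) by rewrite ge_min lexx orbT.
  have -> : d / L = d / (2 * L) + d / (2 * L) by field; rewrite gt_eqF.
  by move: dL; lra.
by move=> /(ub_le_sup (proj2 hS)); rewrite leNgt ss.
Qed.

(* If a unit normal [w] at a point near [x] is far from [- g], then both
   [dot g] and [dot w] are positive at [w + g]; the segment from [c - x] to
   [w + g], scaled down by [t], leaves [A] through a boundary point [x + t q]
   with [dot g q] bounded away from 0. *)
Lemma almost_orthogonal_normals A x c g : closed A -> convex_set A -> A x -> A c ->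
  enorm g = 1 -> 0 < dot g (c - x) -> almost_orthogonal (bd A) x g ->
  normals_near A x (- g).
Proof.
move=> clA cA Ax Ac g1 D0 hg e e0.
set D := dot g (c - x) in D0.
(* [m] is a lower bound for [dot g] at both ends of the segment from [c - x] to [w + g], and [L]
   below bounds the norm along it. *)
set m := Num.min D (e ^+ 2 / 2).
have m0 : 0 < m by rewrite lt_min D0 divr_gt0 // exprn_gt0.
have mD : m <= D by rewrite ge_min lexx.
have me : m <= e ^+ 2 / 2 by rewrite ge_min lexx orbT.
set L := enorm (c - x) + 2.
have L0 : 0 < L by rewrite ltr_wpDl ?enorm_ge0.
have [d1 d10 hd1] := hg (m / (2 * L)) (divr_gt0 m0 (mulr_gt0 (ltr0n _ 2) L0)).
set t := Num.min 1 (d1 / L).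
have t0 : 0 < t by rewrite lt_min ltr01 divr_gt0.
have t1 : t <= 1 by rewrite ge_min lexx.
have td : t * L <= d1 by rewrite -ler_pdivlMr // ge_min lexx orbT.
have te0 : 0 < t * e ^+ 2 / 4 by rewrite divr_gt0 // mulr_gt0 // exprn_gt0.
(* The radius is so small that the supporting hyperplane at [p] separates [x + t (w + g)] from
   [A]. *)
exists (t * e ^+ 2 / 4) => // p w Ap px w1 nw.
rewrite opprK leNgt; apply/negP => wg.
have zz : e ^+ 2 / 2 < 1 + dot w g.
  have : e ^+ 2 < enorm (w + g) ^+ 2 by rewrite ltr_sqr ?nnegrE ?enorm_ge0 // ltW.
  by rewrite enorm_sqrD w1 g1; lra.
have wz : dot w (w + g) = 1 + dot w g by rewrite dotDr -enorm_sqr w1 expr1n.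
have gz : dot g (w + g) = 1 + dot w g.
  by rewrite dotDr -enorm_sqr g1 expr1n (dotC g) addrC.
have nAz : ~ A (x + t *: (w + g)).
  move=> /nw; rewrite addrAC dotDr dotZr wz => h.
  have : - dot w (x - p) <= t * e ^+ 2 / 4.
    rewrite -dotNr opprB; apply: le_trans (dot_le _ _) _; by rewrite w1 mul1r.
  have : t * (e ^+ 2 / 2) < t * (1 + dot w g) by rewrite ltr_pM2l.
  by move: h te0; lra.
have [s [s0 s1]] := bd_crossing clA (convexE cA Ax Ac (ltW t0) t1) nAz.
set q := (c - x) + s *: ((w + g) - (c - x)).
have -> : x + t *: (c - x) + s *: (x + t *: (w + g) - (x + t *: (c - x))) = x + t *: q.
  by apply/rowP => i; rewrite !mxE; ring.
move=> bdq.
have qL : enorm q <= L.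
  have -> : q = (1 - s) *: (c - x) + s *: (w + g).
    by apply/rowP => i; rewrite !mxE; ring.
  apply: le_trans (enormD _ _) _; rewrite !enormZ !ger0_norm ?subr_ge0 //.
  have : enorm (w + g) <= 2 by apply: le_trans (enormD _ _) _; rewrite w1 g1; lra.
  by rewrite /L; have := enorm_ge0 (c - x); have := enorm_ge0 (w + g); nra.
have gq : m <= dot g q.
  have -> : dot g q = (1 - s) * D + s * (1 + dot w g).
    by rewrite (dotDr (c - x)) dotZr (dotDr (w + g)) gz dotNr -/D; ring.
  by have : m <= 1 + dot w g; [lra|nra].
have tq : enorm (t *: q) <= t * L by rewrite enormZ gtr0_norm // ler_pM2l.
have := hd1 _ bdq (le_trans tq td).
have mL : 0 < m / (2 * L) by rewrite divr_gt0 // mulr_gt0.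
move=> h; have := le_trans h (ler_wpM2l (ltW mL) tq).
rewrite dotZr normrM gtr0_norm // => {}h.
have := ler_norm (dot g q).
(* Almost orthogonality now gives [dot g q <= m / 2], against [m <= dot g q]. *)
have E : m / (2 * L) * (t * L) = t * (m / 2) by field; rewrite gt_eqF.
rewrite E ler_pM2l // in h; lra.
Qed.

(** An interior point, shifted along [g] if necessary, lies strictly on one side of the hyperplane;
    its side decides whether [g] or [- g] points outwards. *)
Lemma bd_normals_near A x g : closed A -> convex_set A -> interior A !=set0 -> A x ->
  enorm g = 1 -> almost_orthogonal (bd A) x g ->
  exists2 u, enorm u = 1 & normals_near A x u.
Proof.
move=> clA cA [c /nbhs_enorm [d d0 dA]] Ax g1 hg.
have [c' Ac' D0] : exists2 c', A c' & dot g (c' - x) != 0.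
  have Ac : A c by apply: dA; rewrite subrr enorm0.
  have [D0|] := eqVneq (dot g (c - x)) 0; last by exists c.
  exists (c + (d / 2) *: g).
    by apply: dA; rewrite addrC addKr enormZ g1 gtr0_norm ?divr_gt0 //; lra.
  rewrite addrAC dotDr D0 add0r dotZr -enorm_sqr g1 expr1n mulr1.
  by rewrite gt_eqF // divr_gt0.
have [D1|D1] := ltP 0 (dot g (c' - x)).
  exists (- g); first by rewrite enormN.
  exact: almost_orthogonal_normals D1 hg.
exists g => //; rewrite -(opprK g); apply: almost_orthogonal_normals Ac' _ _ _ => //.
- by rewrite enormN.
- by rewrite dotNl oppr_gt0 lt_neqAle D0.
- exact: almost_orthogonalN.
Qed.

Lemma chart_normals (k : nat) A x (U : set V) (d : nat) (F : V -> 'rV[R]_d) :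
  closed A -> convex_set A -> interior A !=set0 -> A x -> bd A x ->
  chart k.+1 (bd A) x U F ->
  exists2 u, enorm u = 1 & normals_near A x u.
Proof.
move=> clA cA intA Ax bdx cF.
have [g g1 hg] := chart_orthogonal cF bdx (chart_dim_gt0 clA bdx cF).
exact: bd_normals_near hg.
Qed.

End Boundary.

(** * Consequences of linear regularity for the two limit normals *)

Section LinearRegularity.
Context {R : realType} {n : nat}.
Local Notation V := 'rV[R]_n.
Implicit Types (x y z p q u v w b h : V) (A B : set V) (P : V -> V).

Definition linearly_regular A B (K : R) x := exists2 d : R, 0 < d &
  forall y, enorm (y - x) <= d ->
    dist (A `&` B) y <= K * Num.max (dist A y) (dist B y).

(** The residual [y - P y] is a multiple of a unit normal [w] close to [u], so its length is
    [t * dot w b + dot w (x - P y)], where the last term is nonpositive. *)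
Lemma dist_ray A P x u (e : R) : convex_set A -> (forall y, is_proj A y (P y)) ->
  A x -> normals_near A x u -> 0 < e ->
  exists2 d : R, 0 < d & forall b (t : R), enorm b = 1 -> 0 <= t -> t <= d ->
    dist A (x + t *: b) <= t * (Num.max 0 (dot u b) + e).
Proof.
move=> cA hP Ax nA e0; have [d d0 hd] := nA e e0.
exists d => // b t b1 t0 td.
set y := x + t *: b; apply: le_trans (dist_le_proj (hP y)) _.
have [D0|D0] := leP (enorm (y - P y)) 0.
  by apply: le_trans D0 _; rewrite mulr_ge0 // addr_ge0 ?(ltW e0) // le_max lexx.
have [w [w1 nw wE]] := proj_unit_normal cA (hP y) D0.
have px : enorm (P y - x) <= d.
  apply: le_trans (proj_dist_le cA (hP y) Ax) _.
  by rewrite addrC addKr enormZ b1 mulr1 ger0_norm.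
have wu := hd _ _ (proj1 (hP y)) px w1 nw.
have -> : enorm (y - P y) = t * dot w b + dot w (x - P y).
  rewrite -dotZr -dotDr addrA (addrC _ x) -/y wE dotZr -enorm_sqr w1 expr1n mulr1.
  by rewrite -wE.
have wb : dot w b <= Num.max 0 (dot u b) + e.
  have : dot (w - u) b <= e by apply: le_trans (dot_le _ _) _; rewrite b1 mulr1.
  have : dot u b <= Num.max 0 (dot u b) by rewrite le_max lexx orbT.
  by rewrite dotDl dotNl; lra.
by have := nw _ Ax; have := ler_wpM2l t0 wb; lra.
Qed.

(** Test regularity along the bisector [b] of [u] and [v]. Since [b] is normal to the intersection,
    [x + t b] is at distance at least [t] from it, while its distances to [A] and [B] are at most
    [t (N / 2 + e)], where [N = |u + v|]. Hence [2 <= K * N]. *)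
Lemma linearly_regular_angle A B PA PB K x u v : convex_set A -> convex_set B ->
  (forall y, is_proj A y (PA y)) -> (forall y, is_proj B y (PB y)) ->
  A x -> B x -> enorm u = 1 -> enorm v = 1 -> normal A x u -> normal B x v ->
  normals_near A x u -> normals_near B x v ->
  0 < K -> linearly_regular A B K x -> v <> - u ->
  4 <= K ^+ 2 * (2 + 2 * dot u v).
Proof.
move=> cA cB hPA hPB Ax Bx u1 v1 nu nv nA nB K0 [d d0 hd] vu.
have N0 : 0 < enorm (u + v).
  by apply: enorm_gt0 => /eqP; rewrite addrC addr_eq0 => /eqP.
set N := enorm (u + v) in N0; set b := N^-1 *: (u + v).
have NE : N ^+ 2 = 2 + 2 * dot u v by rewrite enorm_sqrD u1 v1; ring.
have b1 : enorm b = 1 by rewrite enormZ gtr0_norm ?invr_gt0 // mulVf ?gt_eqF.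
have half : N^-1 * (1 + dot u v) = N / 2.
  have -> : 1 + dot u v = N ^+ 2 / 2 by rewrite NE; lra.
  by field; rewrite gt_eqF.
have ub : dot u b = N / 2 by rewrite dotZr dotDr -enorm_sqr u1 expr1n.
have vb : dot v b = N / 2.
  by rewrite dotZr dotDr -enorm_sqr v1 expr1n (dotC v) addrC.
have bound e : 0 < e -> 1 <= K * (N / 2 + e).
  move=> e0.
  have [d1 d10 h1] := dist_ray cA hPA Ax nA e0.
  have [d2 d20 h2] := dist_ray cB hPB Bx nB e0.
  set t := Num.min d (Num.min d1 d2).
  have t0 : 0 < t by rewrite !lt_min d0 d10.
  have td : t <= d by rewrite ge_min lexx.
  have t1 : t <= d1 by rewrite !ge_min lexx orbT.
  have t2 : t <= d2 by rewrite !ge_min lexx !orbT.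
  have := hd (x + t *: b); rewrite addrC addKr enormZ b1 mulr1 gtr0_norm // => /(_ td).
  have := h1 b t b1 (ltW t0) t1; have := h2 b t b1 (ltW t0) t2.
  have max0 : Num.max 0 (N / 2) = N / 2 by apply/max_idPr; rewrite divr_ge0 // ltW.
  rewrite ub vb max0 (addrC x) => hB hA hAB.
  have : t <= dist (A `&` B) (t *: b + x).
    apply: le_dist; first by exists x.
    move=> y [Ay By]; have := dot_le (t *: b + x - y) b; rewrite b1 mulr1.
    apply: le_trans; rewrite -addrA dotDl dotZl -enorm_sqr b1 expr1n mulr1.
    rewrite lerDl dotZr pmulr_rge0 ?invr_gt0 // (dotDr u) !(dotC (x - y)).
    have := nu _ Ay; have := nv _ By.
    by rewrite -(opprB x y) !dotNr; lra.
  move=> /le_trans/(_ hAB).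
  have : Num.max (dist A (t *: b + x)) (dist B (t *: b + x)) <= t * (N / 2 + e).
    by rewrite ge_max hA hB.
  move=> /(ler_wpM2l (ltW K0)) hm /le_trans/(_ hm).
  by rewrite mulrCA -[X in X <= _]mulr1 ler_pM2l.
have KN : 1 <= K * (N / 2).
  apply/ler_addgt0Pr => e e0; have := bound (e / K) (divr_gt0 e0 K0).
  by rewrite mulrDr [K * (e / K)]mulrC divfK // gt_eqF.
rewrite -NE -exprMn; have : 2 <= K * N by lra.
by move=> h; have := ler_pM (ler0n _ 2) (ler0n _ 2) h h; rewrite -expr2; lra.
Qed.

(* With opposite normals [A `&` B] lies in the hyperplane orthogonal to [u]
   through [x], and the distances to [A] and [B] grow sublinearly along it, so
   linear regularity forces it to be a neighbourhood of [x] in this hyperplane. *)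
Lemma opposite_normals_flat A B PA PB K x u : convex_set A -> convex_set B ->
  (forall y, is_proj A y (PA y)) -> (forall y, is_proj B y (PB y)) ->
  A x -> B x -> enorm u = 1 -> normal A x u -> normal B x (- u) ->
  normals_near A x u -> normals_near B x (- u) ->
  0 < K -> linearly_regular A B K x ->
  exists2 r : R, 0 < r & forall h, dot u (h - x) = 0 -> enorm (h - x) <= r -> A h.
Proof.
move=> cA cB hPA hPB Ax Bx u1 nu nv nA nB K0 [d d0 hd].
have e0 : 0 < (4 * K)^-1 by rewrite invr_gt0 mulr_gt0.
have [d1 d10 h1] := dist_ray cA hPA Ax nA e0.
have [d2 d20 h2] := dist_ray cB hPB Bx nB e0.
set t := Num.min d (Num.min d1 d2).
have t0 : 0 < t by rewrite !lt_min d0 d10.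
have td : t <= d by rewrite ge_min lexx.
have t1 : t <= d1 by rewrite !ge_min lexx orbT.
have t2 : t <= d2 by rewrite !ge_min lexx !orbT.
exists (t / 2); first by rewrite divr_gt0.
move=> h uh hr; apply: contrapT => nAh.
have D0 : 0 < enorm (h - PA h).
  apply: enorm_gt0 => /eqP; rewrite subr_eq0 => /eqP hE.
  by apply: nAh; rewrite hE; case: (hPA h).
have [w [w1 nw wE]] := proj_unit_normal cA (hPA h) D0.
(* The normal [w] separates [h] from [A]. Its part [wH] along the hyperplane still separates [h]
   from the intersection, because there [y - h] is orthogonal to [u]. Walking from [x] along [wH]
   thus reaches distance [t / 2] from the intersection, whereas regularity allows at most
   [t / 4]. *)
set wH := w - dot u w *: u.
have uwH : dot u wH = 0.
  by rewrite dotDr dotNr dotZr -enorm_sqr u1; ring.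
have wHy y : A y -> B y -> dot wH (y - h) < 0.
  move=> Ay By; have uy : dot u (y - h) = 0.
    have := nu _ Ay; have := nv _ By; rewrite dotNl => k1 k2.
    have -> : y - h = (y - x) - (h - x) by rewrite opprB addrA subrK.
    by rewrite (dotDr (y - x)) dotNr uh; lra.
  rewrite dotDl dotNl dotZl uy mulr0 subr0.
  have := nw _ Ay; have -> : y - PA h = (y - h) + (h - PA h) by rewrite addrA subrK.
  rewrite (dotDr (y - h)) [in X in _ + X]wE dotZr -enorm_sqr w1 expr1n mulr1.
  by lra.
have wH0 : 0 < enorm wH.
  by apply: enorm_gt0 => wH0; have := wHy _ Ax Bx; rewrite wH0 dot0l ltxx.
set b := (enorm wH)^-1 *: wH.
have b1 : enorm b = 1 by rewrite enormZ gtr0_norm ?invr_gt0 // mulVf ?gt_eqF.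
have ub : dot u b = 0 by rewrite dotZr uwH mulr0.
have := hd (x + t *: b); rewrite addrC addKr enormZ b1 mulr1 gtr0_norm // => /(_ td).
have := h1 b t b1 (ltW t0) t1; have := h2 b t b1 (ltW t0) t2.
rewrite dotNl ub oppr0 maxxx add0r (addrC x) => hB hA hAB.
have : t / 2 <= dist (A `&` B) (t *: b + x).
  apply: le_dist; first by exists x.
  move=> y [Ay By]; have := dot_le b (t *: b + x - y); rewrite b1 mul1r.
  apply: le_trans.
  have -> : t *: b + x - y = t *: b - (y - h) - (h - x).
    by apply/rowP => i; rewrite !mxE; ring.
  rewrite dotDr (dotDr (t *: b)) dotZr -enorm_sqr b1 expr1n !dotNr mulr1.
  have k1 : dot b (y - h) < 0 by rewrite dotZl pmulr_rlt0 ?invr_gt0 // wHy.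
  have k2 : dot b (h - x) <= t / 2.
    by apply: le_trans (dot_le _ _) _; rewrite b1 mul1r.
  by lra.
move=> /le_trans/(_ hAB).
have : Num.max (dist A (t *: b + x)) (dist B (t *: b + x)) <= t * (4 * K)^-1.
  by rewrite ge_max hA hB.
move=> /(ler_wpM2l (ltW K0)) hm /le_trans/(_ hm).
have -> : K * (t * (4 * K)^-1) = t / 4 by field; rewrite gt_eqF.
by lra.
Qed.

(** Near [x] the set [A] agrees with the half-space that [u] supports. Above the hyperplane, the
    orthogonal foot of [z] lies in [A] and is the nearest point. *)
Lemma flat_proj A P x u (r : R) : convex_set A -> (forall y, is_proj A y (P y)) ->
  A x -> enorm u = 1 -> normal A x u -> normals_near A x u -> 0 < r ->
  (forall h, dot u (h - x) = 0 -> enorm (h - x) <= r -> A h) ->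
  exists2 d : R, 0 < d & forall z, enorm (z - x) <= d ->
    z - P z = Num.max 0 (dot u (z - x)) *: u.
Proof.
move=> cA hP Ax u1 nu nA r0 hr.
have half0 : 0 < 2^-1 :> R by rewrite invr_gt0.
have [d d0 hd] := nA _ half0.
have foot z : enorm (z - x) <= r -> A (z - dot u (z - x) *: u).
  move=> zr; apply: hr.
    by rewrite addrAC (dotDr (z - x)) dotNr dotZr -enorm_sqr u1; ring.
  apply: le_trans zr; apply: enorm_le; first exact: enorm_ge0.
  rewrite -enorm_sqr addrAC (enorm_sqrD (z - x)) enormN enormZ u1 dotNr dotZr (dotC _ u).
  rewrite mulr1 real_normK ?num_real //.
  by have := sqr_ge0 (dot u (z - x)); lra.
exists (Num.min r d); first by rewrite lt_min r0.
move=> z; rewrite le_min => /andP[zr zd].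
set s := dot u (z - x).
have [s0|s0] := ltP 0 s.
  have zp : enorm (z - P z) <= s.
    apply: le_trans (proj2 (hP z) _ (foot z zr)) _.
    by rewrite opprB addrC subrK enormZ u1 mulr1 gtr0_norm.
  have us : s <= dot u (z - P z).
    have -> : z - P z = (z - x) - (P z - x) by rewrite opprB addrA subrK.
    by rewrite (dotDr (z - x)) dotNr -/s; have := nu _ (proj1 (hP z)); lra.
  apply/eqP; rewrite -subr_eq0; apply/eqP/enorm0_eq0/eqP.
  rewrite -sqrf_eq0 eq_le sqr_ge0 andbT.
  rewrite (enorm_sqrD (z - P z)) enormN enormZ u1 dotNr dotZr (dotC _ u) gtr0_norm // mulr1.
  by have := enorm_ge0 (z - P z); nra.
(* Below the hyperplane, a point outside [A] would have a normal [w] with [dot u w > 0]; the foot of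
   [P z] lies in [A] in direction [u] from [P z], which contradicts normality. *)
rewrite scale0r; apply: enorm0_eq0; apply/eqP; rewrite eq_le enorm_ge0 andbT.
rewrite leNgt; apply/negP => D0.
have [w [w1 nw wE]] := proj_unit_normal cA (hP z) D0.
have pz : enorm (P z - x) <= enorm (z - x) by exact: proj_dist_le (hP z) Ax.
have wu := hd _ _ (proj1 (hP z)) (le_trans pz zd) w1 nw.
have uw : 0 < dot u w.
  have := enorm_sqrD (w - u) u; rewrite subrK w1 u1 dotDl dotNl -enorm_sqr u1 (dotC w).
  by have := enorm_ge0 (w - u); nra.
have up : dot u (P z - x) < 0.
  have -> : P z - x = (z - x) - (z - P z) by rewrite opprB [RHS]addrC addrA subrK.
  by rewrite (dotDr (z - x)) dotNr wE dotZr -/s; have := mulr_gt0 D0 uw; lra.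
have := nw _ (foot _ (le_trans pz zr)); rewrite addrC addKr dotNr dotZr (dotC w).
by nra.
Qed.

End LinearRegularity.

(** * Geometric decay from scalar recursions *)

Section ScalarRecursion.
Context {R : realType}.
Implicit Types (rho mu e : R) (w : nat -> R).

(** The sum [s] absorbs the first [N] terms, [K / mu ^+ N] the tail, and the added 1 makes the
    constant positive. *)
Lemma geometric_bound_shift w mu (N : nat) (K : R) : 0 < mu ->
  (forall j, 0 <= w j) -> (forall j, w (N + j)%N <= K * mu ^+ j) ->
  exists2 C : R, 0 < C & forall j, w j <= C * mu ^+ j.
Proof.
move=> mu0 w0 h; have muj j : 0 < mu ^+ j by exact: exprn_gt0.
set s := \sum_(i < N) w i / mu ^+ i.
have s0 : 0 <= s by apply: sumr_ge0 => i _; rewrite divr_ge0 // ltW.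
have K0 : 0 <= K by have := le_trans (w0 _) (h 0%N); rewrite expr0 mulr1.
have KN : 0 <= K / mu ^+ N by rewrite divr_ge0 // ltW.
exists (K / mu ^+ N + s + 1); first by rewrite ltr_wpDl ?addr_ge0.
move=> j; rewrite -ler_pdivrMr //.
have [jN|Nj] := ltnP j N.
  have : w j / mu ^+ j <= s.
    rewrite /s (bigD1 (Ordinal jN)) //= lerDl.
    by apply: sumr_ge0 => i _; rewrite divr_ge0 // ltW.
  by lra.
have : w j / mu ^+ j <= K / mu ^+ N.
  rewrite ler_pdivrMr // mulrAC -mulrA.
  by rewrite -{2}(subnKC Nj) exprD mulrAC divff ?gt_eqF // mul1r -{1}(subnKC Nj).
by lra.
Qed.

Lemma linear_bound w mu (N : nat) : 0 < mu -> (forall j, 0 <= w j) ->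
  (forall j, (N <= j)%N -> w j.+1 <= mu * w j) ->
  exists2 C : R, 0 < C & forall j, w j <= C * mu ^+ j.
Proof.
move=> mu0 w0 h; apply: (@geometric_bound_shift w mu N (w N)) => //.
elim=> [|j IH]; first by rewrite addn0 expr0 mulr1.
rewrite addnS; apply: le_trans (h _ (leq_addr _ _)) _.
by rewrite exprS mulrCA ler_pM2l.
Qed.

(* The characteristic polynomial [X^2 - 2 rho X + rho^2] has the double root
   [rho]. Perturbed, it is majorized by [(X - m) (X - m')] with
   [0 <= m' < rho < m < mu], and then [w j.+1 - m * w j] is [O(m' ^ j)]. *)
Lemma double_root_bound w rho mu : 0 <= rho -> rho < mu -> (forall j, 0 <= w j) ->
  (forall e, 0 < e -> exists N : nat, forall j, (N <= j)%N ->
     w j.+2 <= Num.max 0 (2 * rho * w j.+1 - rho ^+ 2 * w j + e * (w j.+1 + w j))) ->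
  exists2 C : R, 0 < C & forall j, w j <= C * mu ^+ j.
Proof.
move=> rho0 rmu w0 h; have mu0 : 0 < mu by exact: le_lt_trans rmu.
have muj j : 0 < mu ^+ j by exact: exprn_gt0.
(* For [rho = 0] there is no room for [0 <= m' < rho]. The recursion is then
   [w j.+2 <= e * (w j.+1 + w j)] up to the maximum with 0, and [e] is chosen to make [mu] a root of
   [X^2 = e (X + 1)]. *)
have [rz|rn] := eqVneq rho 0.
  have m1 : 0 < mu + 1 by rewrite ltr_wpDr.
  set e := mu ^+ 2 / (mu + 1).
  have e0 : 0 < e by rewrite divr_gt0 ?exprn_gt0.
  have eE : e * (mu + 1) = mu ^+ 2 by rewrite divfK // gt_eqF.
  have [N hN] := h e e0; set K := w N + w N.+1 / mu.
  have K0 : 0 <= K by rewrite addr_ge0 // divr_ge0 // ltW.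
  apply: (@geometric_bound_shift w mu N K) => // j.
  suff [] : w (N + j)%N <= K * mu ^+ j /\ w (N + j).+1 <= K * mu ^+ j.+1 by [].
  elim: j => [|j [IH1 IH2]].
    rewrite addn0 expr0 expr1 mulr1 mulrDl divfK ?gt_eqF //; split.
      by rewrite lerDl divr_ge0 // ltW.
    by rewrite lerDr mulr_ge0 // ltW.
  rewrite addnS; split=> //; apply: le_trans (hN _ (leq_addr _ _)) _.
  have Kp : 0 <= K * mu ^+ j.+2 by rewrite mulr_ge0 // ltW.
  rewrite ge_max Kp rz expr0n !(mulr0, mul0r) subr0 add0r /=.
  apply: (@le_trans _ _ (e * (K * mu ^+ j.+1 + K * mu ^+ j))).
    by rewrite ler_pM2l // lerD.
  have -> : e * (K * mu ^+ j.+1 + K * mu ^+ j) = K * (e * (mu + 1)) * mu ^+ j.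
    by rewrite exprS; ring.
  by rewrite eE -mulrA -exprD.
have rp : 0 < rho by rewrite lt_neqAle eq_sym rn.
set m := (rho + mu) / 2.
have rm : rho < m by rewrite /m; lra.
have mmu : m < mu by rewrite /m; lra.
have m0 : 0 < m by exact: lt_trans rm.
(* The pair [m], [r] has product [rho ^+ 2] and sum above [2 * rho]. Taking [m'] slightly below [r]
   makes both coefficient inequalities strict, and [e] is the smaller slack. *)
set r := rho ^+ 2 / m.
have rE : r * m = rho ^+ 2 by rewrite divfK // gt_eqF.
have r0 : 0 < r by rewrite divr_gt0 // exprn_gt0.
have rr : r < rho by rewrite ltr_pdivrMr // expr2 ltr_pM2l.
have r2 : 2 * rho - m < r.
  rewrite ltr_pdivlMr //; have : 0 < (m - rho) ^+ 2 by rewrite exprn_gt0 // subr_gt0.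
  by nra.
have [m' [m'0 m'r m'2]] : exists m', [/\ 0 <= m', m' < r & 2 * rho - m < m'].
  exists ((Num.max 0 (2 * rho - m) + r) / 2).
  by have [] := leP (2 * rho - m) 0; split; lra.
set e := Num.min (m + m' - 2 * rho) (rho ^+ 2 - m * m').
have mm : m * m' < rho ^+ 2 by rewrite -rE mulrC ltr_pM2r.
have e0 : 0 < e by rewrite lt_min !subr_gt0 mm andbT; lra.
have e1 : e <= m + m' - 2 * rho by rewrite ge_min lexx.
have e2 : e <= rho ^+ 2 - m * m' by rewrite ge_min lexx orbT.
have [N hN] := h e e0.
set K := Num.max 0 (w N.+1 - m * w N).
have K0 : 0 <= K by rewrite le_max lexx.
have DK j : w (N + j).+1 - m * w (N + j)%N <= K * m' ^+ j.
  elim: j => [|j IH]; first by rewrite addn0 expr0 mulr1 le_max lexx orbT.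
  rewrite addnS; have := hN _ (leq_addr j N).
  have Km : 0 <= K * m' ^+ j by rewrite mulr_ge0 // exprn_ge0.
  have w1 := w0 (N + j)%N; have w2 := w0 (N + j).+1.
  rewrite le_max => /orP[|] hw.
    apply: (@le_trans _ _ 0); last by rewrite mulr_ge0 // exprn_ge0.
    by have := mulr_ge0 (ltW m0) w2; lra.
  rewrite exprS mulrCA; apply: (@le_trans _ _ (m' * (w (N + j).+1 - m * w (N + j)%N))).
    have := ler_wpM2r w2 e1; have := ler_wpM2r w1 e2; lra.
  exact: ler_wpM2l.
(* Chosen so that [m * K2 + K <= mu * K2], which closes the induction on
   [w j.+1 <= m * w j + K * m' ^+ j]. *)
set K2 := Num.max (w N) (K / (mu - m)).
have dm : 0 < mu - m by rewrite subr_gt0.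
apply: (@geometric_bound_shift w mu N K2) => //.
elim=> [|j IH]; first by rewrite addn0 expr0 mulr1 le_max lexx.
rewrite addnS; have := DK j; rewrite lerBlDr => /le_trans; apply.
have m'mu : m' ^+ j <= mu ^+ j.
  by rewrite lerXn2r ?nnegrE ?(ltW mu0) //; lra.
have KK : K <= K2 * (mu - m) by rewrite -ler_pdivrMr // le_max lexx orbT.
have := ler_wpM2l (ltW m0) IH; have := ler_wpM2l K0 m'mu.
by have := ler_wpM2r (ltW (muj j)) KK; rewrite exprS; lra.
Qed.

End ScalarRecursion.

(** * From geometric steps to a geometric rate *)

Section Telescope.
Context {R : realType} {n : nat}.

Lemma geometric_steps_cvg (x : nat -> 'rV[R]_n) (l : 'rV[R]_n) (C q : R) :
  0 <= C -> 0 < q -> q < 1 ->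
  (forall k, enorm (x k.+1 - x k) <= C * q ^+ k) ->
  (forall e : R, 0 < e -> exists N : nat, forall k, (N <= k)%N -> enorm (x k - l) <= e) ->
  forall k, enorm (x k - l) <= C / (1 - q) * q ^+ k.
Proof.
move=> C0 q0 q1 hx xl k.
have d0 : 0 < 1 - q by rewrite subr_gt0.
(* The bound is the exact partial geometric sum, so the induction closes with an equality. *)
have step i : enorm (x k - x (k + i)%N) <= C / (1 - q) * (q ^+ k - q ^+ (k + i)).
  elim: i => [|i IH]; first by rewrite addn0 !subrr enorm0 mulr0.
  apply: le_trans (enormB _ (x (k + i)%N) _) _.
  rewrite addnS; apply: le_trans (lerD IH _) _.
    by rewrite enormBC; exact: hx.
  rewrite -subr_ge0 le_eqVlt; apply/orP; left; apply/eqP.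
  by rewrite exprS; field; rewrite gt_eqF.
apply/ler_addgt0Pr => e e0; have [N hN] := xl e e0.
apply: le_trans (enormB _ (x (k + N)%N) _) _; apply: lerD.
  apply: le_trans (step N) _; rewrite ler_wpM2l ?divr_ge0 ?(ltW d0) //.
  by rewrite gerBl exprn_ge0 // ltW.
by apply: hN; rewrite leq_addl.
Qed.

End Telescope.

(** * Alternating relaxed projections: global convergence *)

Definition gap {R : realType} {n : nat} (P : nat -> 'rV[R]_n -> 'rV[R]_n)
  (z : nat -> 'rV[R]_n) (j : nat) : R := enorm (z j - P j (z j)).

Section RelaxedProjections.
Context {R : realType} {n : nat}.
Local Notation V := 'rV[R]_n.
Context (S : nat -> set V) (P : nat -> V -> V) (a : R) (z : nat -> V).
Hypothesis closedS : forall j, closed (S j).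
Hypothesis convexS : forall j, convex_set (S j).
Hypothesis projS : forall j x, is_proj (S j) x (P j x).
Hypothesis S2 : forall j, S j.+2 = S j.
Hypothesis P2 : forall j, P j.+2 = P j.
Hypothesis zS : forall j, z j.+1 = z j - a *: (z j - P j (z j)).
Hypothesis a_ge1 : 1 <= a.
Hypothesis a_lt2 : a < 2.

Local Notation w := (gap P z).

Let w_ge0 j : 0 <= w j. Proof. exact: enorm_ge0. Qed.

Let projS1 j x : S j (P j x). Proof. exact: proj1 (projS j x). Qed.

Lemma odd_period j : S j = S (odd j).
Proof.
suff [] : S j = S (odd j) /\ S j.+1 = S (odd j.+1) by [].
by elim: j => [//|j [IH1 IH2]]; split; rewrite // S2 IH1 /= negbK.
Qed.

(** In the expanded square, the obtuse angle at [P j (z j)] bounds the inner product below by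
    [w j ^+ 2]. *)
Lemma fejer c j : (forall i, S i c) ->
  enorm (z j.+1 - c) ^+ 2 <= enorm (z j - c) ^+ 2 - a * (2 - a) * w j ^+ 2.
Proof.
move=> Sc; rewrite zS addrAC (enorm_sqrD (z j - c)) enormN enormZ dotNr dotZr.
rewrite exprMn real_normK ?num_real // -/(w j).
have : w j ^+ 2 <= dot (z j - c) (z j - P j (z j)).
  have -> : z j - c = (z j - P j (z j)) + (P j (z j) - c) by rewrite addrA subrK.
  rewrite dotDl -enorm_sqr lerDl dotC -(opprB c) dotNr oppr_ge0.
  by apply: (proj_normal (@convexS j) (projS j _)).
have : 0 <= a by exact: le_trans a_ge1.
by move=> a0 /(ler_wpM2l a0); lra.
Qed.

Let gap_gt0 : 0 < a * (2 - a).
Proof. by rewrite mulr_gt0 ?subr_gt0 // (lt_le_trans ltr01). Qed.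

Lemma fejer_le c j k : (forall i, S i c) -> (j <= k)%N ->
  enorm (z k - c) <= enorm (z j - c).
Proof.
move=> Sc /subnKC <-; elim: (k - j)%N => [|i IH]; first by rewrite addn0.
apply: le_trans IH; rewrite addnS -ler_sqr ?nnegrE ?enorm_ge0 //.
apply: le_trans (fejer _ Sc) _; rewrite gerBl mulr_ge0 ?sqr_ge0 //.
exact: ltW.
Qed.

(** Once the decreasing squared distances to [c] are within [a (2 - a) e^2] of their infimum, no
    step can have a gap of [e] or more. *)
Lemma gaps_small c (e : R) : (forall i, S i c) -> 0 < e ->
  exists N : nat, forall j, (N <= j)%N -> w j < e.
Proof.
move=> Sc e0; set E := [set enorm (z j - c) ^+ 2 | j in setT].
have hE : has_inf E.
  split; first by exists (enorm (z 0%N - c) ^+ 2); exists 0%N.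
  by exists 0 => _ [j _ <-]; exact: sqr_ge0.
have ge0 : 0 < a * (2 - a) * e ^+ 2 by rewrite mulr_gt0 ?exprn_gt0.
have [_ [N _ <-] hN] := inf_adherent ge0 hE.
exists N => j Nj; rewrite -ltr_sqr ?nnegrE ?(ltW e0) // -(ltr_pM2l gap_gt0).
have := fejer j Sc.
have : inf E <= enorm (z j.+1 - c) ^+ 2 by apply: ge_inf; [exact: (proj2 hE)|exists j.+1].
have : enorm (z j - c) ^+ 2 <= enorm (z N - c) ^+ 2.
  by rewrite ler_sqr ?nnegrE ?enorm_ge0 //; exact: fejer_le.
by lra.
Qed.

Lemma cluster_point c : (forall i, S i c) ->
  exists l, forall (d : R) (N : nat), 0 < d -> exists2 j, (N <= j)%N & enorm (z j - l) < d.
Proof.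
move=> Sc; set M := enorm (z 0%N - c) + enorm c.
have cK := @rV_compact _ n (fun _ => `[- M, M]%classic) (fun _ => @segment_compact R (- M) M).
have zK j i : `[- M, M]%classic (z j ord0 i).
  rewrite /= in_itv /= -ler_norml.
  apply: (@le_trans _ _ (enorm (z j))); last first.
    rewrite -[z j](subrK c); apply: le_trans (enormD _ _) _.
    by rewrite lerD2r; exact: fejer_le.
  apply: le_trans (normr_le_enorm _); rewrite [X in _ <= X]/Num.Def.normr /= mx_normrE.
  exact: (@le_bigmax _ _ _ _ (fun ij : 'I_1 * 'I_n => `|z j ij.1 ij.2|) (ord0, i)).
have [l [_ cl]] : exists l : V, ([set v : V | forall i, `[- M, M]%classic (v ord0 i)] `&`
    cluster (z j @[j --> \oo])) l.
  by apply: (cK (z j @[j --> \oo])); exists 0%N => // j _ i; exact: zK.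
exists l => d N d0.
have nl : nbhs l [set y | enorm (y - l) < d] by apply/nbhs_enorm; exists d.
have [|y [[j Nj <-] yd]] := cl [set z j | j in [set j | (N <= j)%N]] _ _ nl.
  by exists N => // j Nj; exists j.
by exists j.
Qed.

(** A cluster point lies in both sets, since gaps vanish and one further step switches parity. Fejer
    monotonicity towards the cluster point itself then gives full convergence. *)
Lemma relaxed_projections_cvg c : (forall i, S i c) ->
  exists2 l, (forall i, S i l) & forall e : R, 0 < e ->
    exists N : nat, forall j, (N <= j)%N -> enorm (z j - l) <= e.
Proof.
move=> Sc; have [l hl] := cluster_point Sc.
have Sl i : S i l.
  apply: closed_enorm => // e e0.
  have e4 : 0 < e / 4 by rewrite divr_gt0.
  have [N hN] := gaps_small Sc e4.
  have [j Nj jl] := hl _ N e4.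
  have far k : (N <= k)%N -> odd k = odd i -> enorm (z k - l) < e / 4 + e / 2 ->
      exists2 y, S i y & enorm (y - l) < e.
    move=> Nk ki kl; exists (P k (z k)).
      by rewrite (odd_period i) -ki -odd_period.
    apply: le_lt_trans (enormB _ (z k) _) _.
    by rewrite enormBC; have := hN _ Nk; rewrite /gap; lra.
  have [ji|ji] := eqVneq (odd j) (odd i); first by apply: (far j) => //; lra.
  apply: (far j.+1); [exact: leqW|by move: ji => /=; case: (odd j); case: (odd i)|].
  rewrite zS addrAC; apply: le_lt_trans (enormD _ _) _.
  rewrite enormN enormZ ger0_norm; last exact: le_trans a_ge1.
  have := hN _ Nj; have := w_ge0 j; rewrite /gap => w0 we.
  have : a * enorm (z j - P j (z j)) <= 2 * enorm (z j - P j (z j)).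
    by rewrite ler_wpM2r // ltW.
  by lra.
exists l => // e e0; have [N _ hN] := hl e 0%N e0.
by exists N => j Nj; apply: le_trans (ltW hN); exact: fejer_le.
Qed.

(** * Recursions for the gaps near the limit *)

Section Local.
Context (l : V) (U : nat -> V) (rho : R).
Hypothesis Sl : forall j, S j l.
Hypothesis zl : forall e : R, 0 < e ->
  exists N : nat, forall j, (N <= j)%N -> enorm (z j - l) <= e.
Hypothesis normalsU : forall j, normals_near (S j) l (U j).
Hypothesis U2 : forall j, U j.+2 = U j.
Hypothesis U1 : forall j, enorm (U j) <= 1.
Hypothesis aE : a = 1 + rho ^+ 2.

(** One radius per parity yields an [N] valid for all [j]. The first estimate also covers [w j = 0],
    where there is no residual to normalize. *)
Lemma proj_near_normal (e : R) : 0 < e -> exists N : nat, forall j, (N <= j)%N ->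
  enorm (z j - P j (z j) - w j *: U j) <= e * w j /\
  (0 < w j -> exists W, [/\ enorm W = 1, normal (S j) (P j (z j)) W,
     z j - P j (z j) = w j *: W & enorm (W - U j) <= e]).
Proof.
move=> e0; have [d0 d00 h0] := normalsU 0 e0; have [d1 d10 h1] := normalsU 1 e0.
set d := Num.min d0 d1.
have hd j p W : S j p -> enorm (p - l) <= d -> enorm W = 1 -> normal (S j) p W ->
    enorm (W - U j) <= e.
  have -> : U j = U (odd j).
    suff [] : U j = U (odd j) /\ U j.+1 = U (odd j.+1) by [].
    by elim: j => [//|j [IH1 IH2]]; split; rewrite // U2 IH1 /= negbK.
  by rewrite odd_period le_min => Sp /andP[p0 p1]; case: (odd j) Sp => Sp W1 nW;
     [exact: h1 nW|exact: h0 nW].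
have dd : 0 < d by rewrite lt_min d00.
have [N hN] := zl dd.
exists N => j Nj.
have unit_normal : 0 < w j -> exists W, [/\ enorm W = 1, normal (S j) (P j (z j)) W,
    z j - P j (z j) = w j *: W & enorm (W - U j) <= e].
  move=> wj; have [W [W1 nW WE]] := proj_unit_normal (@convexS j) (projS j _) wj.
  exists W; split=> //; apply: hd nW => //.
  by apply: le_trans (hN _ Nj); exact: proj_dist_le (projS j _) (Sl j).
split=> //; have [wj|wj] := leP (w j) 0.
  have wj0 : w j = 0 by apply/eqP; rewrite eq_le wj w_ge0.
  by rewrite wj0 scale0r subr0 mulr0 -wj0.
have [W [_ _ -> We]] := unit_normal wj.
by rewrite -scalerBr enormZ ger0_norm // mulrC ler_wpM2r.
Qed.

(* [z j.+2] is obtained from [z j] by moving along [z j - P j (z j)] and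
   [z j.+1 - P j.+1 (z j.+1)], which are nearly parallel to [U j] and [U j.+1].
   Testing against the normal at [P j (z j.+2)], which supports [S j] and
   hence dominates [P j (z j)], gives an upper bound for the new gap. *)
Lemma gap_recursion (e : R) : - (a * dot (U 0%N) (U 1%N)) <= 2 * rho -> 0 < e ->
  exists N : nat, forall j, (N <= j)%N ->
    w j.+2 <= Num.max 0 (2 * rho * w j.+1 - rho ^+ 2 * w j + e * (w j.+1 + w j)).
Proof.
(* Replacing [W] and the step direction by limit normals costs [e / 4] each; the weights
   [rho ^+ 2 <= 1] and [a < 2] keep the total within [e]. *)
move=> angle e0; have e4 : 0 < e / 4 by rewrite divr_gt0.
have [N hN] := proj_near_normal e4; exists N => j Nj.
have UU : dot (U j) (U j.+1) = dot (U 0%N) (U 1%N).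
  by elim: (j) => [//|i IH]; rewrite U2 dotC.
have [h0 _] := hN j Nj.
have [h1 _] := hN j.+1 (leqW Nj).
have [_ h2] := hN j.+2 (leqW (leqW Nj)).
have [w2|w2] := leP (w j.+2) 0; first by rewrite le_max w2.
have [W [W1 nW WE We]] := h2 w2; rewrite U2 in We.
rewrite le_max; apply/orP; right.
set D0 := z j - P j (z j) in h0; set D1 := z j.+1 - P j.+1 (z j.+1) in h1.
have w2E : w j.+2 <= (1 - a) * dot W D0 - a * dot W D1.
  have -> : w j.+2 = dot W (z j.+2 - P j.+2 (z j.+2)).
    by rewrite WE dotZr -enorm_sqr W1 expr1n mulr1.
  have Sp : S j.+2 (P j (z j)) by rewrite S2.
  have -> : (1 - a) * dot W D0 - a * dot W D1 = dot W (z j.+2 - P j (z j)).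
    have -> : z j.+2 = z j - a *: D0 - a *: D1 by rewrite [LHS]zS [X in X - _]zS.
    have -> : z j - a *: D0 - a *: D1 - P j (z j) = (1 - a) *: D0 - a *: D1.
      by rewrite /D0; apply/rowP => i; rewrite !mxE; ring.
    by rewrite (dotDr ((1 - a) *: D0)) (dotNr W (a *: D1)) !dotZr.
  have := nW _ Sp.
  have -> : P j (z j) - P j.+2 (z j.+2) =
      (z j.+2 - P j.+2 (z j.+2)) - (z j.+2 - P j (z j)).
    by rewrite opprB [RHS]addrC addrA subrK.
  by rewrite (dotDr (z j.+2 - P j.+2 (z j.+2))) dotNr; lra.
have WU : 1 - e / 4 <= dot W (U j).
  have -> : dot W (U j) = 1 - dot W (W - U j).
    by rewrite dotDr dotNr -enorm_sqr W1 expr1n; ring.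
  have := dot_le W (W - U j); rewrite W1 mul1r; lra.
have WU1 : dot (U j) (U j.+1) - e / 4 <= dot W (U j.+1).
  have -> : dot W (U j.+1) = dot (U j) (U j.+1) + dot (W - U j) (U j.+1).
    by rewrite -dotDl addrC subrK.
  rewrite lerD2l lerNl -dotNr; apply: le_trans (dot_le _ _) _; rewrite enormN.
  apply: le_trans (ler_pM (enorm_ge0 _) (enorm_ge0 _) We (U1 _)) _.
  by rewrite mulr1.
have k0 : w j * (1 - e / 4) - e / 4 * w j <= dot W D0.
  have -> : D0 = w j *: U j + (D0 - w j *: U j) by rewrite addrC subrK.
  rewrite (dotDr (_ *: _)) dotZr; apply: lerD; first by rewrite ler_wpM2l.
  rewrite lerNl -dotNr; apply: le_trans (dot_le _ _) _.
  by rewrite W1 mul1r enormN.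
have k1 : w j.+1 * (dot (U j) (U j.+1) - e / 4) - e / 4 * w j.+1 <= dot W D1.
  have -> : D1 = w j.+1 *: U j.+1 + (D1 - w j.+1 *: U j.+1) by rewrite addrC subrK.
  rewrite (dotDr (_ *: _)) dotZr; apply: lerD; first by rewrite ler_wpM2l.
  rewrite lerNl -dotNr; apply: le_trans (dot_le _ _) _.
  by rewrite W1 mul1r enormN.
apply: le_trans w2E _; rewrite -UU in angle.
have r2 : 0 <= rho ^+ 2 by exact: sqr_ge0.
have a1E : 1 - a = - rho ^+ 2 by rewrite aE; ring.
have m0 := ler_wpM2l r2 k0.
have a0 : 0 <= a by exact: le_trans a_ge1.
have m1 := ler_wpM2l a0 k1.
have m2 := ler_wpM2r (w_ge0 j.+1) angle.
have r1 : rho ^+ 2 <= 1 by have := a_lt2; rewrite aE; lra.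
have n0 : rho ^+ 2 * (e * w j) <= 1 * (e * w j) by rewrite ler_wpM2r // mulr_ge0 // ltW.
have n1 : a * (e * w j.+1) <= 2 * (e * w j.+1).
  by rewrite ler_wpM2r ?mulr_ge0 // ltW.
have p0 : 0 <= e * w j by rewrite mulr_ge0 // ltW.
rewrite a1E; lra.
Qed.

(** With the signed height [s j] of [z j] along [U j], the gap is [max (0, s j)]; as the normal
    flips sign, [s j.+1 = a * max (0, s j) - s j]. *)
Lemma flat_gap_recursion :
  (forall j, U j.+1 = - U j) -> (forall j, enorm (U j) = 1) ->
  (forall j, exists2 d : R, 0 < d & forall y, enorm (y - l) <= d ->
    y - P j y = Num.max 0 (dot (U j) (y - l)) *: U j) ->
  exists N : nat, forall j, (N <= j)%N -> w j.+1 <= rho ^+ 2 * w j.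
Proof.
move=> UN Un hP; have [d0 d00 h0] := hP 0%N; have [d1 d10 h1] := hP 1%N.
have Podd j : P j = P (odd j) /\ U j = U (odd j).
  suff [] : (P j = P (odd j) /\ U j = U (odd j)) /\
            (P j.+1 = P (odd j.+1) /\ U j.+1 = U (odd j.+1)) by [].
  elim: j => [//|j [[IH1 IH2] IH3]]; split; first by [].
  by rewrite P2 U2 IH1 IH2 /= negbK.
have dd : 0 < Num.min d0 d1 by rewrite lt_min d00.
have [N hN] := zl dd.
pose s j := dot (U j) (z j - l).
have step j : (N <= j)%N -> z j - P j (z j) = Num.max 0 (s j) *: U j.
  move=> /hN; rewrite le_min /s => /andP[zd0 zd1].
  by have [-> ->] := Podd j; case: (odd j); [exact: h1|exact: h0].
have wE j : (N <= j)%N -> w j = Num.max 0 (s j).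
  move=> Nj; rewrite /gap (step _ Nj) enormZ Un mulr1 ger0_norm //.
  by rewrite le_max lexx.
have sS j : (N <= j)%N -> s j.+1 = a * Num.max 0 (s j) - s j.
  move=> Nj; rewrite /s zS UN addrAC dotNl (dotDr (z j - l)) (step _ Nj) dotNr !dotZr.
  by rewrite -enorm_sqr Un expr1n -/(s j); ring.
(* After one step the height is nonnegative, and from then on it is multiplied by [a - 1]. *)
exists N.+1 => -[//|j] Nj; rewrite ltnS in Nj.
have s1 : 0 <= s j.+1.
  rewrite sS //; have [sj|sj] := leP (s j) 0; first by rewrite mulr0 sub0r oppr_ge0.
  by rewrite subr_ge0 ler_peMl // ltW.
rewrite !wE ?(leqW (leqW Nj)) ?(leqW Nj) // sS ?(leqW Nj) //.
rewrite (max_idPr s1) aE ge_max mulr_ge0 ?sqr_ge0 //=.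
by rewrite mulrDl mul1r addrAC subrr add0r.
Qed.

End Local.
End RelaxedProjections.

(** * The GAP iteration as half-steps, its limit and its parameters *)

Definition alternate (T : Type) (s t : T) (j : nat) : T := if odd j then t else s.

Lemma alternateSS (T : Type) (s t : T) (j : nat) :
  alternate s t j.+2 = alternate s t j.
Proof. by rewrite /alternate /= negbK. Qed.

Lemma alternateP (T : Type) (Q : T -> Prop) (s t : T) (j : nat) :
  Q s -> Q t -> Q (alternate s t j).
Proof. by rewrite /alternate; case: (odd j). Qed.

Section GAP.
Context {R : realType} {n : nat}.
Local Notation V := 'rV[R]_n.
Implicit Types (A B : set V) (PA PB P : V -> V) (x u v : V).

(** Half-step 0 uses [PB], the inner operator of GAP, so the GAP iterates are the even terms. *)
Fixpoint gap_half PA PB (a : R) x0 (j : nat) : V :=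
  if j is i.+1 then relax (alternate PB PA i) a (gap_half PA PB a x0 i) else x0.

Lemma relaxE P (a : R) x : relax P a x = x - a *: (x - P x).
Proof. by rewrite /relax; apply/rowP => i; rewrite !mxE; ring. Qed.

Lemma gap_seqE PA PB (a : R) x0 (k : nat) :
  gap_seq PA PB 1 a a x0 k = gap_half PA PB a x0 k.*2.
Proof.
elim: k => [//|k IH]; rewrite /gap_seq iterS -/(gap_seq _ _ _ _ _ _ k) IH.
by rewrite subrr scale0r add0r scale1r doubleS /= /alternate /= odd_double.
Qed.

Definition smooth_or_interior A x := interior A x \/
  (bd A x /\ exists k (U : set V) d (F : V -> 'rV[R]_d), chart k.+1 (bd A) x U F).

Lemma condC_smooth A B x :
  condC A B x -> smooth_or_interior A x /\ smooth_or_interior B x.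
Proof.
case=> [[bA bB [k [k2 [UM [dM [FM [UN [dN [FN [_ [_ [_ [cM cN _ _]]]]]]]]]]]]]|
        [iA bB [U [d [F cF]]]]|[bA iB [U [d [F cF]]]]|[iA iB]].
- case: k k2 cM cN => // k _ cM cN; split; right; split=> //.
    by exists k, UM, dM, FM.
  by exists k, UN, dN, FN.
- by split; [left|right; split=> //; exists 1%N, U, d, F].
- by split; [right; split=> //; exists 1%N, U, d, F|left].
- by split; left.
Qed.

(** The value [u = 0] encodes an interior point; the angle bound is then trivial, so interior points
    share the general recursion. *)
Lemma limit_normal A P x : closed A -> convex_set A -> interior A !=set0 ->
  (forall y, is_proj A y (P y)) -> A x -> smooth_or_interior A x ->
  exists2 u, normals_near A x u & u = 0 \/ enorm u = 1 /\ normal A x u.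
Proof.
move=> clA cA iA hP Ax [intx|[bdx [k [U [d [F cF]]]]]].
  by exists 0; [exact: interior_normals_near|left].
have [u u1 nA] := chart_normals clA cA iA Ax bdx cF.
by exists u => //; right; split=> //; exact: (bd_normal clA cA hP bdx nA).
Qed.

Lemma linearly_regularC A B (K : R) x :
  linearly_regular A B K x -> linearly_regular B A K x.
Proof. by case=> d d0 h; exists d => // y /h; rewrite setIC maxC. Qed.

Lemma gap_half_step PA PB (a : R) x0 j :
  gap_half PA PB a x0 j.+1 = gap_half PA PB a x0 j -
    a *: (gap_half PA PB a x0 j - alternate PB PA j (gap_half PA PB a x0 j)).
Proof. exact: relaxE. Qed.

Lemma gap_half_rate A B PA PB (K a rho : R) x0 :
  closed A -> closed B -> convex_set A -> convex_set B ->
  interior A !=set0 -> interior B !=set0 -> (A `&` B) !=set0 ->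
  (forall x, (A `&` B) x -> condC A B x) ->
  0 < K -> (forall x, (A `&` B) x -> linearly_regular A B K x) ->
  (forall x, is_proj A x (PA x)) -> (forall x, is_proj B x (PB x)) ->
  0 <= rho -> rho < 1 -> a = 1 + rho ^+ 2 ->
  (forall c : R, 4 <= K ^+ 2 * (2 + 2 * c) -> - (a * c) <= 2 * rho) ->
  let z := gap_half PA PB a x0 in
  exists x, [/\ (A `&` B) x,
    forall e : R, 0 < e ->
      exists N : nat, forall j, (N <= j)%N -> enorm (z j - x) <= e &
    forall mu : R, rho < mu -> exists2 C : R, 0 < C &
      forall j, gap (alternate PB PA) z j <= C * mu ^+ j].
Proof.
move=> clA clB cA cB iA iB [c [Ac Bc]] hC K0 hreg hPA hPB rho0 rho1 aE hangle z.
have rho2 : rho ^+ 2 < 1 by rewrite expr_lt1.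
have a1 : 1 <= a by rewrite aE lerDl sqr_ge0.
have a2 : a < 2 by rewrite aE; lra.
pose S := alternate B A; pose P := alternate PB PA.
have clS j : closed (S j) by exact: (alternateP (Q := closed)).
have cS j : convex_set (S j) by exact: (alternateP (Q := fun s => convex_set s)).
have hPS j y : is_proj (S j) y (P j y) by rewrite /S /P /alternate; case: (odd j).
have inS y : A y -> B y -> forall j, S j y.
  by move=> Ay By j; apply: (alternateP (Q := fun s : set V => s y)).
have S2 j : S j.+2 = S j by exact: alternateSS.
have P2 j : P j.+2 = P j by exact: alternateSS.
have zS j : z j.+1 = z j - a *: (z j - P j (z j)) by exact: gap_half_step.
have [x Sx zx] := relaxed_projections_cvg clS cS hPS S2 zS a1 a2 (inS _ Ac Bc).
have Ax : A x := Sx 1%N; have Bx : B x := Sx 0%N.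
exists x; split=> // mu rmu.
have w0 j : 0 <= gap P z j by exact: enorm_ge0.
have [sA sB] := condC_smooth (hC _ (conj Ax Bx)).
have reg := hreg _ (conj Ax Bx).
have [u nA hu] := limit_normal clA cA iA hPA Ax sA.
have [v nB hv] := limit_normal clB cB iB hPB Bx sB.
have unit_le y (Q : Prop) : y = 0 \/ enorm y = 1 /\ Q -> enorm y <= 1.
  by case=> [->|[-> _]]; rewrite ?enorm0 ?ler01.
pose U := alternate v u.
have U2 j : U j.+2 = U j by exact: alternateSS.
have U1 j : enorm (U j) <= 1.
  by apply: (alternateP (Q := fun y => enorm y <= 1)); [exact: unit_le hv|exact: unit_le hu].
have nU j : normals_near (S j) x (U j) by rewrite /S /U /alternate; case: (odd j).
(* A zero limit normal, or regularity with [v <> - u], yields the angle bound; its failure therefore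
   leaves only [v = - u]. *)
have [|flat] := pselect (- (a * dot v u) <= 2 * rho).
  move=> angle; apply: (double_root_bound rho0 rmu w0) => e e0.
  exact: (gap_recursion (@cS) hPS S2 zS a1 a2 Sx zx nU U2 U1 aE angle e0).
case: hu => [u0|[u1 nu]].
  by case: flat; rewrite u0 dotC dot0l mulr0 oppr0 mulr_ge0.
case: hv => [v0|[v1 nv]]; first by case: flat; rewrite v0 dot0l mulr0 oppr0 mulr_ge0.
have vu : v = - u.
  apply: contrapT => vu; apply: flat; apply: hangle; rewrite dotC.
  exact: (linearly_regular_angle cA cB hPA hPB Ax Bx u1 v1 nu nv nA nB K0 reg vu).
have uv : u = - v by rewrite vu opprK.
have [rA rA0 hA] : exists2 r : R, 0 < r &
    forall h, dot u (h - x) = 0 -> enorm (h - x) <= r -> A h.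
  by apply: (opposite_normals_flat cA cB hPA hPB Ax Bx u1 nu _ nA _ K0 reg); rewrite -vu.
have [rB rB0 hB] : exists2 r : R, 0 < r &
    forall h, dot v (h - x) = 0 -> enorm (h - x) <= r -> B h.
  apply: (opposite_normals_flat cB cA hPB hPA Bx Ax v1 nv _ nB _ K0 (linearly_regularC reg)).
    by rewrite -uv.
  by rewrite -uv.
have fA := flat_proj cA hPA Ax u1 nu nA rA0 hA.
have fB := flat_proj cB hPB Bx v1 nv nB rB0 hB.
have [N hN] : exists N : nat, forall j, (N <= j)%N ->
    gap P z j.+1 <= rho ^+ 2 * gap P z j.
  apply: (flat_gap_recursion P2 zS a1 zx U2 aE).
  - by move=> j; rewrite /U /alternate /=; case: (odd j).
  - by move=> j; rewrite /U /alternate; case: (odd j).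
  - by move=> j; rewrite /U /P /alternate; case: (odd j).
apply: (linear_bound (N := N)) => //; first exact: le_lt_trans rmu.
move=> j /hN /le_trans; apply; rewrite ler_wpM2r //.
by apply: le_trans (ltW rmu); rewrite expr2 ler_piMl // ltW.
Qed.

(** The floor [sqrt 2] on [kappa] gives [s >= 1], hence [rho >= 0]. The formula for [a] is
    [(s + 1)^2 + (s - 1)^2 = 2 (s^2 + 1)], where [s^2 + 1 = kappa^2]. *)
Lemma gap_parameters (K : R) :
  let kappa := Num.max K (Num.sqrt 2) in
  let s := Num.sqrt (kappa ^+ 2 - 1) in
  let a := 2 * (kappa / (s + 1)) ^+ 2 in
  let rho := (s - 1) / (s + 1) in
  0 < K ->
  [/\ 0 <= rho, rho < 1, a = 1 + rho ^+ 2 &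
    forall c : R, 4 <= K ^+ 2 * (2 + 2 * c) -> - (a * c) <= 2 * rho].
Proof.
move=> kappa s a rho K0.
have kK : K <= kappa by rewrite le_max lexx.
have k2 : 2 <= kappa ^+ 2.
  rewrite -[X in X <= _](@sqr_sqrtr _ 2) // lerXn2r ?nnegrE ?sqrtr_ge0 //.
    by rewrite (le_trans (ltW K0)).
  by rewrite le_max lexx orbT.
have sE : kappa ^+ 2 = s ^+ 2 + 1 by rewrite sqr_sqrtr; lra.
have s0 : 0 <= s by exact: sqrtr_ge0.
have s1 : 1 <= s by rewrite -(ler_sqr) ?nnegrE // expr1n; lra.
have s1p : 0 < s + 1 by lra.
have s1n : s + 1 != 0 by rewrite gt_eqF.
have aE : a = 2 * (s ^+ 2 + 1) / (s + 1) ^+ 2.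
  by rewrite /a expr_div_n sE; field.
split.
- by rewrite divr_ge0 ?subr_ge0 // ltW.
- by rewrite ltr_pdivrMr //; lra.
- by rewrite aE /rho; field.
move=> c hc.
(* Enlarging [K] to [kappa] is allowed because the hypothesis itself forces [2 + 2 * c >= 0]. *)
have hc' : 4 <= (s ^+ 2 + 1) * (2 + 2 * c).
  apply: (le_trans hc); rewrite -sE ler_wpM2r //.
    have : 0 < K ^+ 2 by exact: exprn_gt0.
    by move=> KK; rewrite -(pmulr_rge0 _ KK); apply: le_trans hc.
  by rewrite lerXn2r ?nnegrE // ltW // (lt_le_trans K0).
rewrite aE /rho -subr_ge0.
have -> : 2 * ((s - 1) / (s + 1)) - - (2 * (s ^+ 2 + 1) / (s + 1) ^+ 2 * c) =
    ((s ^+ 2 + 1) * (2 + 2 * c) - 4) / (s + 1) ^+ 2 by field.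
by rewrite divr_ge0 ?subr_ge0 // sqr_ge0.
Qed.

End GAP.

Unset Implicit Arguments. Set Strict Implicit. Set Printing Implicit Defensive.

Theorem theorem11 (R : realType) (n : nat) (A B : set 'rV[R]_n)
    (PA PB : 'rV[R]_n -> 'rV[R]_n) (khat : R) (x0 : 'rV[R]_n) :
  closed A -> closed B -> convex_set A -> convex_set B ->
  interior A !=set0 -> interior B !=set0 -> (A `&` B) !=set0 ->
  (forall xs, (A `&` B) xs -> condC A B xs) ->
  0 < khat ->
  (forall xs, (A `&` B) xs -> exists2 delta : R, 0 < delta &
     forall x, enorm (x - xs) <= delta ->
       dist (A `&` B) x <= khat * Num.max (dist A x) (dist B x)) ->
  (forall x, is_proj A x (PA x)) -> (forall x, is_proj B x (PB x)) ->
  let kappa := Num.max khat (Num.sqrt 2) in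
  let a1 := 2 * (kappa / (Num.sqrt (kappa ^+ 2 - 1) + 1)) ^+ 2 in
  let gamma := ((Num.sqrt (kappa ^+ 2 - 1) - 1) /
                (Num.sqrt (kappa ^+ 2 - 1) + 1)) ^+ 2 in
  exists2 xs, (A `&` B) xs &
    forall mu : R, gamma < mu < 1 ->
      exists2 C : R, 0 < C &
        forall k : nat, enorm (gap_seq PA PB 1 a1 a1 x0 k - xs) <= C * mu ^+ k.
Proof.
move=> clA clB cA cB iA iB AB hC K0 hreg hPA hPB kappa a gamma.
have [rho0 rho1 aE angle] := gap_parameters K0.
have [x [ABx zx rate]] := gap_half_rate x0 clA clB cA cB iA iB AB hC K0 hreg hPA hPB
  rho0 rho1 aE angle.
exists x => // mu /andP[gmu mu1].
have mu0 : 0 < mu by apply: le_lt_trans gmu; exact: sqr_ge0.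
have m0 : 0 <= Num.sqrt mu by exact: sqrtr_ge0.
have mE : Num.sqrt mu ^+ 2 = mu by rewrite sqr_sqrtr // ltW.
(* One GAP iteration is two half-steps, so rate [mu] per iteration is [sqrt mu] per half-step, and
   [gamma < mu] becomes [rho < sqrt mu]. *)
have [|C C0 hw] := rate (Num.sqrt mu).
  by rewrite -ltr_sqr ?nnegrE // mE.
have a0 : 0 < a by rewrite (aE : a = 1 + gamma) ltr_pwDl ?sqr_ge0.
(* The k-th GAP step has length at most [a (w_(2k) + w_(2k+1))], hence at most [D * mu ^+ k]. *)
set D := a * C * (1 + Num.sqrt mu).
have D0 : 0 < D by rewrite (mulr_gt0 (mulr_gt0 a0 C0)) ?ltr_pwDl.
exists (D / (1 - mu)); first by rewrite divr_gt0 // subr_gt0.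
apply: (geometric_steps_cvg (ltW D0) mu0 mu1) => [k|e e0].
  rewrite !gap_seqE doubleS -/a.
  set z := gap_half PA PB a x0; set P := alternate PB PA.
  have wE j : gap P z j <= C * Num.sqrt mu ^+ j by exact: hw.
  have -> : z k.*2.+2 - z k.*2 =
    - (a *: (z k.*2 - P k.*2 (z k.*2)) + a *: (z k.*2.+1 - P k.*2.+1 (z k.*2.+1))).
    rewrite [z k.*2.+2]gap_half_step [X in X - _ - _]gap_half_step.
    by rewrite addrAC (addrAC (z _)) subrr sub0r opprD.
  rewrite enormN; apply: le_trans (enormD _ _) _.
  rewrite !enormZ gtr0_norm // -!/(gap P z _).
  have := wE k.*2; have := wE k.*2.+1.
  rewrite exprS -mul2n exprM mE => h1 h0.
  rewrite -mulrDr; apply: (le_trans (ler_wpM2l (ltW a0) (lerD h0 h1))).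
  by rewrite le_eqVlt /D; apply/orP; left; apply/eqP; ring.
have [N hN] := zx e e0.
exists N => k Nk; rewrite gap_seqE; apply: hN.
by apply: leq_trans Nk _; rewrite -addnn leq_addr.
Qed.
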